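(* Let $\omega(n)\to\infty$ as $n\to\infty$. If $$p\geq \left(\frac{3\log n+\omega(n)}{n}\right)^{1/2},$$ then asymptotically almost surely $\pi_1(Y)=0$ for $Y\in Y(n,p)$.
   Context: The Linial–Meshulam random $2$-complex $Y(n,p)$ is the probability space of $2$-dimensional simplicial complexes on vertex set $[n]=\{1,\dots,n\}$ whose edge set is all of $\binom{[n]}{2}$ (complete $1$-skeleton), with each of the $\binom{n}{3}$ possible $2$-faces included independently with probability $p=p(n)$. A property holds asymptotically almost surely (a.a.s.) if its probability tends to $1$ as $n\to\infty$. *)

(* Defs.v *)
From HB Require Import structures.
From mathcomp Require Import all_boot all_order all_algebra.
From mathcomp Require Import all_classical all_reals all_analysis.
Set Implicit Arguments.
Unset Strict Implicit.
Unset Printing Implicit Defensive.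
Import Order.TTheory GRing.Theory Num.Theory.
Import numFieldNormedType.Exports.

Local Open Scope classical_set_scope.
Local Open Scope ring_scope.

Section FundamentalGroup.
Variables (R : realType) (T : topologicalType).
Implicit Types (X : set T) (x : T) (f g : R -> T).

Local Notation I := (`[0 : R, 1 : R]%classic).

(* Loops are functions on all of R of which only the restriction to [0, 1]
   matters: [loop_homotopic] ignores the values outside [0, 1]. *)
Definition loop X x : set (R -> T) :=
  [set f : R -> T | [/\ {within I, continuous f},
                      f @` I `<=` X, f 0 = x & f 1 = x]].

(* Homotopy of loops in X, relative to the endpoints. *)
Definition loop_homotopic X x f g : Prop :=
  exists H : R * R -> T,
    [/\ {within I `*` I, continuous H},
        H @` (I `*` I) `<=` X,
        forall s, I s -> H (s, 0) = f s /\ H (s, 1) = g s &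
        forall t, I t -> H (0, t) = x /\ H (1, t) = x].

Definition loop_class X x f : set (R -> T) :=
  loop X x `&` loop_homotopic X x f.

(* The underlying set of the fundamental group of X based at x; its neutral
   element is [loop_class X x (cst x)]. *)
Definition pi1 X x : set (set (R -> T)) :=
  [set loop_class X x f | f in loop X x].

(* The fundamental group is the trivial group, whatever the base point. *)
Definition pi1_trivial X : Prop :=
  forall x, X x -> pi1 X x = [set loop_class X x (cst x)].

End FundamentalGroup.

Arguments pi1_trivial R {T} X.

(* A finite abstract simplicial complex on 'I_n is the set of its nonempty
   simplices; its realization is given by barycentric coordinates, as a
   subspace of R^n. *)
Definition realization (R : realType) (n : nat) (K : {set {set 'I_n}}) :
    set 'rV[R]_n :=
  [set x : 'rV[R]_n | [/\ forall i, 0 <= x ord0 i,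
                          \sum_i x ord0 i = 1 &
                          [set i | x ord0 i != 0]%SET \in K]].

Arguments realization R {n} K.

Section LinialMeshulam.
Variables (R : realType) (n : nat).
Implicit Types (F : {set {set 'I_n}}) (p : R).

Definition triples : {set {set 'I_n}} := [set t : {set 'I_n} | #|t| == 3]%SET.

(* The complex with complete 1-skeleton and set of 2-faces F. *)
Definition LM_complex F : {set {set 'I_n}} :=
  [set s : {set 'I_n} | (0 < #|s| <= 2)%N || (s \in F)]%SET.

Definition LM_weight p F : R :=
  \prod_(t in triples) (if t \in F then p else 1 - p).

(* The probability that Y in Y(n, p) satisfies Q. *)
Definition LM_prob p (Q : {set {set 'I_n}} -> Prop) : R :=
  \sum_(F in powerset triples | `[< Q (LM_complex F) >]) LM_weight p F.

End LinialMeshulam.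

(* Main.v *)
Require Import Defs.
From HB Require Import structures.
From mathcomp Require Import all_boot all_order all_algebra.
From mathcomp Require Import all_classical all_reals all_analysis.
From mathcomp Require Import ring lra zify.
Set Implicit Arguments.
Unset Strict Implicit.
Unset Printing Implicit Defensive.
Import Order.TTheory GRing.Theory Num.Theory.
Import numFieldNormedType.Exports.

(** If the links of every two distinct vertices a, b meet in a connected graph
  on the other n - 2 vertices, then Y is simply connected: an edge xy of that
  graph bounds with a and b two faces axy and bxy, so the paths a-x-b and a-y-b
  are homotopic; hence so are all the paths a-c-b, and one of them is homotopic
  to the edge ab because ab lies on a face (n >= 4). So every triangle of the
  complete 1-skeleton is null-homotopic.

  This is lifted to the realization as in van Kampen's theorem: a path from z
  to y is homotopic to the canonical path z -> v -> w -> y for all vertices v, w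
  of the supports of z and y. For the restrictions of a path to [0, s] this
  holds for an open and closed set of s, since near s the path stays in the
  open star of a vertex, which is star-shaped.

  The common link of a and b is a random graph with n - 2 vertices and edge
  probability q = p^2. By a union bound over a, b and the smaller side, of size
  k, of a disconnection, the failure probability is at most
  n^2 * sum_k C(n-2,k) (1-q)^(k(n-2-k)) = O(exp(-omega)). *)

Local Open Scope classical_set_scope.
Local Open Scope ring_scope.

(** * Continuity of pointwise operations *)

Section Continuity.
Variables (R : realType) (T : topologicalType) (V : normedModType R).

Lemma contD (f g : T -> V) : continuous f -> continuous g ->
  continuous (fun q => f q + g q).
Proof. by move=> cf cg q; apply: cvgD; [exact: cf|exact: cg]. Qed.

Lemma contB (f g : T -> V) : continuous f -> continuous g ->
  continuous (fun q => f q - g q).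
Proof. by move=> cf cg q; apply: cvgB; [exact: cf|exact: cg]. Qed.

Lemma contZ (k : T -> R) (f : T -> V) : continuous k -> continuous f ->
  continuous (fun q => k q *: f q).
Proof. by move=> cf cg q; apply: cvgZ; [exact: cf|exact: cg]. Qed.

Lemma contM (f g : T -> R) : continuous f -> continuous g ->
  continuous (fun q => f q * g q).
Proof. by move=> cf cg q; apply: cvgM; [exact: cf|exact: cg]. Qed.

Lemma cont_min (f g : T -> R) : continuous f -> continuous g ->
  continuous (fun q => Num.min (f q) (g q)).
Proof. by move=> cf cg q; apply: continuous_min; [exact: cf|exact: cg]. Qed.

Lemma cont_max (f g : T -> R) : continuous f -> continuous g ->
  continuous (fun q => Num.max (f q) (g q)).
Proof. by move=> cf cg q; apply: continuous_max; [exact: cf|exact: cg]. Qed.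

Lemma cont_cst (U : topologicalType) (c : U) : continuous (fun _ : T => c).
Proof. by move=> q; exact: cvg_cst. Qed.

Lemma cont_id : continuous (fun q : T => q).
Proof. by move=> q; exact: cvg_id. Qed.

Lemma cont_comp (U W : topologicalType) (f : U -> W) (g : T -> U) :
  continuous f -> continuous g -> continuous (fun q => f (g q)).
Proof. by move=> cf cg q; apply: continuous_comp; [exact: cg|exact: cf]. Qed.

Lemma cont_pair (U W : topologicalType) (f : T -> U) (g : T -> W) :
  continuous f -> continuous g -> continuous (fun q => (f q, g q)).
Proof. by move=> cf cg q; apply: cvg_pair; [exact: cf|exact: cg]. Qed.

Lemma cont_fst (U : topologicalType) : continuous (fun q : T * U => q.1).
Proof. by move=> q; exact: cvg_fst. Qed.

Lemma cont_snd (U : topologicalType) : continuous (fun q : T * U => q.2).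
Proof. by move=> q; exact: cvg_snd. Qed.
End Continuity.

(** * The retraction of the real line onto the unit interval *)

Section Clamp.
Variable R : realType.
Implicit Types s t : R.

Definition clamp s : R := Num.max 0 (Num.min 1 s).

Lemma clampP s : [\/ s <= 0 /\ clamp s = 0, 0 <= s <= 1 /\ clamp s = s |
                     1 <= s /\ clamp s = 1].
Proof.
rewrite /clamp; have [h1|h1] := leP 1 s.
- by apply: Or33; rewrite max_r.
- have [h0|h0] := leP 0 s; first by apply: Or32; rewrite (ltW h1).
  by apply: Or31; rewrite (ltW h0).
Qed.

Lemma clamp_le0 s : s <= 0 -> clamp s = 0.
Proof. by move=> ?; case: (clampP s) => -[] *; lra. Qed.

Lemma clamp_ge1 s : 1 <= s -> clamp s = 1.
Proof. by move=> ?; case: (clampP s) => -[] *; lra. Qed.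

Lemma clamp_id s : 0 <= s <= 1 -> clamp s = s.
Proof. by move=> ?; case: (clampP s) => -[] *; lra. Qed.

Lemma clamp_ge0 s : 0 <= clamp s.
Proof. by case: (clampP s) => -[] *; lra. Qed.

Lemma clamp_le1 s : clamp s <= 1.
Proof. by case: (clampP s) => -[] *; lra. Qed.

Lemma clamp_itv s : 0 <= clamp s <= 1.
Proof. by rewrite clamp_ge0 clamp_le1. Qed.

Lemma cont_clamp (T : topologicalType) (f : T -> R) :
  continuous f -> continuous (fun q => clamp (f q)).
Proof.
move=> cf; rewrite /clamp; apply: cont_max; first exact: cont_cst.
by apply: cont_min => //; exact: cont_cst.
Qed.
End Clamp.

(** Differences are tried before sums: [f - g] is also a sum, and splitting it as one would leave an
    opposite that no rule handles. *)
Ltac cont :=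
  repeat match goal with
  | |- continuous (fun _ => ?c) => exact: cont_cst
  | |- continuous (fun q => q) => exact: cont_id
  | |- continuous (fun q => q.1) => exact: cont_fst
  | |- continuous (fun q => q.2) => exact: cont_snd
  | |- continuous (fun q => clamp (@?f q)) => apply: (@cont_clamp _ _ f)
  | |- continuous (fun q => Num.min (@?f q) (@?g q)) =>
      apply: (@cont_min _ _ f g)
  | |- continuous (fun q => Num.max (@?f q) (@?g q)) =>
      apply: (@cont_max _ _ f g)
  | |- continuous (fun q => (@?f q, @?g q)) => apply: (@cont_pair _ _ _ f g)
  | |- continuous (fun q => @?f q - @?g q) => apply: (@contB _ _ _ f g)
  | |- continuous (fun q => @?f q + @?g q) => apply: (@contD _ _ _ f g)
  | |- continuous (fun q => @?f q * @?g q) => apply: (@contM _ _ f g)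
  | |- continuous (fun q => @?f q *: @?g q) => apply: (@contZ _ _ _ f g)
  | H : continuous ?f |- continuous (fun q => ?f (@?g q)) =>
      apply: (@cont_comp _ _ _ f g H)
  | H : continuous ?f |- continuous ?f => exact: H
  end.

(** * Paths and homotopies in a subset of a normed space *)

Section Homotopy.
Variables (R : realType) (V : normedModType R).
Implicit Types (X A : set V) (f g h : R -> V) (x y z c : V) (s t : R).

(* Paths are parametrized by R and constant outside [0, 1], so that the
   concatenation [pcat] below is a plain sum, hence visibly continuous. *)
Definition path_in X x y f : Prop :=
  [/\ continuous f, forall s, X (f s), forall s, s <= 0 -> f s = x &
      forall s, 1 <= s -> f s = y].

Definition homotopic X x y f g : Prop :=
  exists H : R * R -> V,
    [/\ continuous H, forall q, X (H q),
        forall s t, t <= 0 -> H (s, t) = f s,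
        forall s t, 1 <= t -> H (s, t) = g s &
        (forall s t, s <= 0 -> H (s, t) = x) /\
        (forall s t, 1 <= s -> H (s, t) = y)].

Definition pcat y f g : R -> V := fun s => f (2 * s) + g (2 * s - 1) - y.

Definition line x y : R -> V := fun s => x + clamp s *: (y - x).

Lemma homotopic_refl X x y f : path_in X x y f -> homotopic X x y f f.
Proof.
move=> [cf fX f0 f1]; exists (fun q => f q.1); split => //; first by cont.
by split => s t /= ?; [exact: f0|exact: f1].
Qed.

Lemma homotopic_sym X x y f g : homotopic X x y f g -> homotopic X x y g f.
Proof.
move=> [H [cH XH H0 H1 [Hx Hy]]]; exists (fun q => H (q.1, 1 - q.2)).
split => //=; [by cont| | |by split => s t ?; [apply: Hx|apply: Hy]].
- by move=> s t ?; apply: H1; lra.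
- by move=> s t ?; apply: H0; lra.
Qed.

Lemma homotopic_trans X x y g f h :
  homotopic X x y f g -> homotopic X x y g h -> homotopic X x y f h.
Proof.
move=> [H [cH XH H0 H1 [Hx Hy]]] [K [cK XK K0 K1 [Kx Ky]]].
(* The homotopies are glued by the same sum as in [pcat]: up to time 1/2 the [K] term equals [g],
   afterwards the [H] term does, and it cancels. *)
exists (fun q => H (q.1, 2 * q.2) + K (q.1, 2 * q.2 - 1) - g q.1).
have cg : continuous g.
  rewrite (_ : g = fun s => H (s, 1)); first by cont.
  by apply/funext => s; rewrite H1.
split => /=.
- by cont.
- move=> [s t] /=; have [h0|h0] := leP t (1 / 2).
  + by rewrite K0 ?addrK //; lra.
  + by rewrite H1 1?addrC ?addKr //; lra.
- by move=> s t ?; rewrite K0 ?addrK ?H0 //; lra.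
- by move=> s t ?; rewrite H1 1?addrC ?addKr ?K1 //; lra.
- have gx s : s <= 0 -> g s = x by move=> ?; rewrite -(H1 s 1) ?Hx.
  have gy s : 1 <= s -> g s = y by move=> ?; rewrite -(H1 s 1) ?Hy.
  by split=> s t ?; [rewrite Hx ?Kx ?gx ?addrK|rewrite Hy ?Ky ?gy ?addrK].
Qed.

Lemma homotopicW X Y x y f g :
  X `<=` Y -> homotopic X x y f g -> homotopic Y x y f g.
Proof.
by move=> XY [H [cH XH H0 H1 H2]]; exists H; split => // q; exact: XY.
Qed.

Lemma homotopic_pcat X x y z f f' g g' :
  homotopic X x y f f' -> homotopic X y z g g' ->
  homotopic X x z (pcat y f g) (pcat y f' g').
Proof.
move=> [H [cH XH H0 H1 [Hx Hy]]] [K [cK XK K0 K1 [Kx Ky]]].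
exists (fun q => H (2 * q.1, q.2) + K (2 * q.1 - 1, q.2) - y).
split => /=.
- by cont.
- move=> [s t] /=; have [h0|h0] := leP s (1 / 2).
  + by rewrite Kx ?addrK //; lra.
  + by rewrite Hy 1?addrC ?addKr //; lra.
- by move=> s t ?; rewrite /pcat H0 ?K0.
- by move=> s t ?; rewrite /pcat H1 ?K1.
- split=> s t ?; first by rewrite Hx ?Kx ?addrK //; lra.
  by rewrite Hy 1?addrC ?addKr ?Ky //; lra.
Qed.

Lemma path_in_pcat X x y z f g : path_in X x y f -> path_in X y z g ->
  path_in X x z (pcat y f g).
Proof.
move=> [cf fX f0 f1] [cg gX g0 g1]; split; rewrite /pcat.
- by cont.
- move=> s; have [h0|h0] := leP s (1 / 2).
  + by rewrite g0 ?addrK //; lra.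
  + by rewrite f1 1?addrC ?addKr //; lra.
- by move=> s ?; rewrite f0 ?g0 ?addrK //; lra.
- by move=> s ?; rewrite f1 1?addrC ?addKr ?g1 //; lra.
Qed.

(** The parameters are interpolated linearly in the real line; as [f] maps the whole line into [X],
    the homotopy never leaves [X]. *)
Lemma homotopic_reparam X f (phi psi : R -> R) a b :
  continuous f -> (forall s, X (f s)) -> continuous phi -> continuous psi ->
  (forall s, s <= 0 -> phi s = a /\ psi s = a) ->
  (forall s, 1 <= s -> phi s = b /\ psi s = b) ->
  homotopic X (f a) (f b) (f \o phi) (f \o psi).
Proof.
move=> cf fX cphi cpsi h0 h1.
exists (fun q => f (phi q.1 + clamp q.2 * (psi q.1 - phi q.1))).
split => /=.
- by cont.
- by [].
- by move=> s t ?; rewrite clamp_le0 // mul0r addr0.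
- by move=> s t ?; rewrite clamp_ge1 // mul1r addrC subrK.
- split=> s t hs.
    by have [-> ->] := h0 _ hs; rewrite subrr mulr0 addr0.
  by have [-> ->] := h1 _ hs; rewrite subrr mulr0 addr0.
Qed.

Lemma homotopic_assoc X x y z w f g h :
  path_in X x y f -> path_in X y z g -> path_in X z w h ->
  homotopic X x w (pcat z (pcat y f g) h) (pcat y f (pcat z g h)).
Proof.
move=> [cf fX f0 f1] [cg gX g0 g1] [ch hX h0 h1].
(* With u the clamped second coordinate, [g] runs exactly while 4s goes from 1 + u to 2 + u. By then
   [f] has ended and [h] has not begun, so at most one summand moves at a time and the endpoints
   cancel. *)
exists (fun q => f (q.1 * (4 - 2 * clamp q.2)) +
                 (g (4 * q.1 - 1 - clamp q.2) - y) +
                 (h (2 * q.1 - 1 + clamp q.2 * (2 * q.1 - 2)) - z)).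
split => /=.
- by cont.
- move=> [s t] /=; have := clamp_itv t; move: (clamp t) => u u01.
  have [hs|hs] := leP (4 * s) (1 + u).
    rewrite (g0 (_ - _)); last by lra.
    by rewrite (h0 (_ + _)) ?subrr ?addr0 //; nra.
  have [hs'|hs'] := leP (4 * s) (2 + u).
    rewrite (f1 (_ * _)); last by nra.
    by rewrite (h0 (_ + _)) ?subrr ?addr0 1?addrC ?subrK //; nra.
  rewrite (f1 (_ * _)); last by nra.
  by rewrite (g1 (_ - _)) ?[y + _]addrC ?subrK ?[z + _]addrC ?subrK //; lra.
- move=> s t t0; rewrite clamp_le0 // /pcat mul0r !addr0 !subr0 mulr0 subr0.
  rewrite [s * 4]mulrC (_ : 2 * (2 * s) = 4 * s); last by ring.
  by rewrite !addrA.
- move=> s t t0; rewrite clamp_ge1 // /pcat mul1r mulr1.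
  rewrite (_ : s * _ = 2 * s); last by ring.
  rewrite (_ : 4 * s - 1 - 1 = 2 * (2 * s - 1)); last by ring.
  rewrite (_ : 2 * s - 1 + _ = 2 * (2 * s - 1) - 1); last by ring.
  rewrite -!addrA; congr (_ + (_ + _)).
  by rewrite [- y + _]addrC -!addrA.
- split => s t hs; have := clamp_itv t; move: (clamp t) => u u01.
    rewrite f0; last by nra.
    rewrite g0; last by lra.
    by rewrite h0 ?subrr ?addr0 //; nra.
  rewrite f1; last by nra.
  rewrite g1; last by lra.
  by rewrite h1 ?[y + _]addrC ?subrK ?[z + _]addrC ?subrK //; nra.
Qed.

Lemma homotopic_starshaped X A c x y f g : A `<=` X ->
  (forall v t, A v -> 0 <= t <= 1 -> A (c + t *: (v - c))) ->
  path_in A x y f -> path_in A x y g -> homotopic X x y f g.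
Proof.
move=> AX Ac pf pg; apply: (homotopicW AX).
(* At time t, go straight from x towards c up to the fraction t of the way, run
   the copy of f shrunk by that fraction, and go straight to y. At t = 1 the
   path rests at c in the middle third, so it only depends on x, y and c. *)
pose mu s t := Num.max 0 (Num.min 1 (Num.max (1 - clamp t)
  (Num.max (1 - 3 * s) (3 * s - 2)))).
pose sg s t := s + clamp t * (2 * s - 1).
pose P f s := c + mu s 1 *: (f (sg s 1) - c).
have H k : path_in A x y k -> homotopic A x y k (P k).
  move=> [ck kA k0 k1].
  exists (fun q => c + mu q.1 q.2 *: (k (sg q.1 q.2) - c)).
  have mu01 s t : 0 <= mu s t <= 1.
    by rewrite /mu le_max lexx ge_max ler01 ge_min lexx.
  have mu1 s t : 1 <= Num.max (1 - clamp t) (Num.max (1 - 3 * s) (3 * s - 2)) ->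
      mu s t = 1.
    by move=> ?; rewrite /mu min_l // max_r.
  have E v : c + 1 *: (v - c) = v by rewrite scale1r addrC subrK.
  split => /=.
  - by rewrite /mu /sg; cont.
  - by move=> [s t]; exact: Ac.
  - move=> s t t0; rewrite mu1; last by rewrite clamp_le0 // subr0 le_max lexx.
    by rewrite /sg clamp_le0 // mul0r addr0.
  - by move=> s t t1; rewrite /P /mu /sg !clamp_ge1.
  - split => s t hs; rewrite mu1 ?E.
    + by apply: k0; rewrite /sg; have := clamp_itv t; nra.
    + by rewrite !le_max; apply/orP; right; apply/orP; left; lra.
    + by apply: k1; rewrite /sg; have := clamp_itv t; nra.
    + by rewrite !le_max; apply/orP; right; apply/orP; right; lra.
suff PE : P f = P g.
  apply: (@homotopic_trans _ _ _ (P f)); first exact: H.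
  by rewrite PE; apply: homotopic_sym; exact: H.
case: pf pg => [_ _ f0 f1] [_ _ g0 g1].
apply/funext => s; rewrite /P /sg clamp_ge1 // mul1r.
have [h0|h0] := leP (3 * s) 1; first by rewrite f0 ?g0 //; lra.
have [h1|h1] := leP 2 (3 * s); first by rewrite f1 ?g1 //; lra.
suff -> : mu s 1 = 0 by rewrite !scale0r.
rewrite /mu clamp_ge1 // subrr max_l // ge_min !ge_max lexx /=.
by apply/orP; right; apply/andP; split; lra.
Qed.

Lemma path_in_line X x y : (forall t, 0 <= t <= 1 -> X (x + t *: (y - x))) ->
  path_in X x y (line x y).
Proof.
move=> h; split; rewrite /line.
- by cont.
- by move=> s; apply: h; exact: clamp_itv.
- by move=> s ?; rewrite clamp_le0 // scale0r addr0.
- by move=> s ?; rewrite clamp_ge1 // scale1r addrC subrK.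
Qed.

Lemma path_inW X Y x y f : X `<=` Y -> path_in X x y f -> path_in Y x y f.
Proof. by move=> XY [? fX ? ?]; split => // s; exact: XY. Qed.
End Homotopy.

(** * Simplices, open stars and edge paths in the realization *)

Section Realization.
Variables (R : realType) (n : nat) (K : {set {set 'I_n}}).
Hypothesis K_edges : forall s : {set 'I_n}, (0 < #|s| <= 2)%N -> s \in K.
Hypothesis K_closed : forall s t : {set 'I_n},
  t \in K -> s \subset t -> (0 < #|s|)%N -> s \in K.

Local Notation V := 'rV[R]_n.
Local Notation X := (realization R K).
Implicit Types (S : {set 'I_n}) (u v w a b c : 'I_n) (x y z : V) (s t : R).

Local Notation supp x := [set i | x ord0 i != 0]%SET.

Definition vertex v : V := delta_mx ord0 v.

(** The closed simplex spanned by [S]: the support may be smaller than [S], which makes the set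
    convex. *)
Definition simplex S : set V :=
  [set x : V | [/\ forall i, 0 <= x ord0 i, \sum_i x ord0 i = 1 &
                   forall i, x ord0 i != 0 -> i \in S]].

(** The open star of [v]. *)
Definition star v : set V := [set x | X x /\ x ord0 v != 0].

Lemma supp_gt0 x : \sum_i x ord0 i = 1 ->
  (0 < #|supp x|)%N.
Proof.
move=> x1; rewrite card_gt0; apply/negP => /eqP x0.
have : \sum_i x ord0 i = 0.
  apply: big1 => i _; apply/eqP.
  by move/setP: x0 => /(_ i); rewrite !inE => /negbFE.
by rewrite x1 => /eqP; rewrite oner_eq0.
Qed.

Lemma simplex_sub S : S \in K -> simplex S `<=` X.
Proof.
move=> SK x [x0 x1 xS]; split => //; apply: (K_closed SK); last exact: supp_gt0.
by apply/fintype.subsetP => i; rewrite inE; exact: xS.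
Qed.

Lemma simplex_convex S x y t : simplex S x -> simplex S y -> 0 <= t <= 1 ->
  simplex S (x + t *: (y - x)).
Proof.
move=> [x0 x1 xS] [y0 y1 yS] /andP[t0 t1].
have E i : (x + t *: (y - x)) ord0 i = (1 - t) * x ord0 i + t * y ord0 i.
  by rewrite !mxE; ring.
split.
- by move=> i; rewrite E addr_ge0 ?mulr_ge0 ?subr_ge0.
- under eq_bigr do rewrite E.
  by rewrite big_split /= -!mulr_sumr x1 y1; ring.
- move=> i; rewrite E.
  have [->|/xS //] := eqVneq (x ord0 i) 0.
  have [->|/yS //] := eqVneq (y ord0 i) 0.
  by rewrite !mulr0 addr0 eqxx.
Qed.

Lemma simplex_vertex S v : v \in S -> simplex S (vertex v).
Proof.
move=> vS; split.
- by move=> i; rewrite mxE ler0n.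
- rewrite (bigD1 v) //= big1; first by rewrite addr0 mxE !eqxx.
  by move=> i /negbTE iv; rewrite mxE iv andbF.
- by move=> i; rewrite mxE; case: (eqVneq i v) => [->|] //; rewrite andbF eqxx.
Qed.

Lemma simplex_supp x : X x -> simplex (supp x) x.
Proof. by move=> [x0 x1 xK]; split => // i; rewrite inE. Qed.

Lemma path_simplex S x y : simplex S x -> simplex S y ->
  path_in (simplex S) x y (line x y).
Proof.
by move=> Sx Sy; apply: path_in_line => t t01; exact: simplex_convex.
Qed.

Lemma homotopic_simplex S x y f g : S \in K ->
  path_in (simplex S) x y f -> path_in (simplex S) x y g ->
  homotopic X x y f g.
Proof.
move=> SK pf pg.
apply: (homotopic_starshaped (simplex_sub SK) _ pf pg (c := x)).
move=> z t Sz t01; apply: simplex_convex => //.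
by case: pf => _ fS /(_ 0 (lexx _)) <- _; exact: fS.
Qed.

Lemma star_vertex v : star v (vertex v).
Proof.
split; last by rewrite mxE !eqxx oner_eq0.
by apply: (@simplex_sub [set v]%SET);
  [apply: K_edges; rewrite cards1|apply: simplex_vertex; rewrite inE].
Qed.

(** The segment stays in the closed simplex on the support of [x], which contains [v], and its
    coordinate at [v] is (1 - t) + t x_v > 0. *)
Lemma star_starshaped v x t : star v x -> 0 <= t <= 1 ->
  star v (vertex v + t *: (x - vertex v)).
Proof.
move=> [Xx xv] /andP[t0 t1]; have Sx := simplex_supp Xx.
have xK : (supp x) \in K by case: Xx.
split.
  apply: (simplex_sub xK); apply: simplex_convex => //; last by rewrite t0.
  by apply: simplex_vertex; rewrite inE.
rewrite !mxE !eqxx /= gt_eqF //.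
rewrite (_ : 1%:R + _ = (1 - t) + t * x ord0 v); last by ring.
have [->|tn0] := eqVneq t 0; first by rewrite subr0 mul0r addr0.
have tp : 0 < t by rewrite lt_neqAle eq_sym tn0.
have xv0 : 0 < x ord0 v.
  by case: Xx => x0 _ _; rewrite lt_neqAle eq_sym xv x0.
by apply: ltr_wpDl; [rewrite subr_ge0|exact: mulr_gt0].
Qed.

Lemma path_to_vertex v x : star v x ->
  path_in (star v) x (vertex v) (line x (vertex v)).
Proof.
move=> sx; apply: path_in_line => t t01.
rewrite (_ : _ + _ = vertex v + (1 - t) *: (x - vertex v)).
  by apply: star_starshaped => //; lra.
by apply/rowP => i; rewrite !mxE; ring.
Qed.

Lemma path_from_vertex v x : star v x ->
  path_in (star v) (vertex v) x (line (vertex v) x).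
Proof. by move=> sx; apply: path_in_line => t t01; exact: star_starshaped. Qed.

Lemma starS v : star v `<=` X.
Proof. by move=> x []. Qed.

Lemma homotopic_star v x y f g :
  path_in (star v) x y f -> path_in (star v) x y g -> homotopic X x y f g.
Proof.
apply: homotopic_starshaped (@starS v) _ => z t; exact: star_starshaped.
Qed.

Lemma edge_in a b : [set a; b]%SET \in K.
Proof. by apply: K_edges; rewrite cards2; case: (a != b). Qed.

Definition edge a b := line (vertex a) (vertex b).

Lemma path_edge a b : path_in X (vertex a) (vertex b) (edge a b).
Proof.
apply: path_inW (simplex_sub (edge_in a b)) _.
by apply: path_simplex; apply: simplex_vertex; rewrite !inE eqxx ?orbT.
Qed.

Definition edge2 a b c := pcat (vertex b) (edge a b) (edge b c).

Lemma path_edge2 a b c : path_in X (vertex a) (vertex c) (edge2 a b c).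
Proof. by apply: path_in_pcat; exact: path_edge. Qed.

Lemma homotopic_edge2 S a b c : S \in K -> a \in S -> b \in S -> c \in S ->
  homotopic X (vertex a) (vertex c) (edge2 a b c) (edge a c).
Proof.
move=> SK aS bS cS; apply: (homotopic_simplex SK).
  by apply: path_in_pcat; apply: path_simplex; exact: simplex_vertex.
by apply: path_simplex; exact: simplex_vertex.
Qed.

(** Both paths are compared with a-x-y-b: [T] contracts x-y-b to x-b, and [S] contracts a-x-y to
    a-y. *)
Lemma homotopic_edge2_swap (a b x y : 'I_n) (S T : {set 'I_n}) :
  S \in K -> T \in K ->
  a \in S -> x \in S -> y \in S -> b \in T -> x \in T -> y \in T ->
  homotopic X (vertex a) (vertex b) (edge2 a x b) (edge2 a y b).
Proof.
move=> SK TK aS xS yS bT xT yT.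
apply: (@homotopic_trans _ _ _ _ _ (pcat (vertex x) (edge a x) (edge2 x y b))).
  apply: homotopic_pcat; first by apply: homotopic_refl; exact: path_edge.
  by apply: homotopic_sym; exact: homotopic_edge2 TK _ _ _.
apply: (@homotopic_trans _ _ _ _ _ (pcat (vertex y) (edge2 a x y) (edge y b))).
  by apply: homotopic_sym; apply: homotopic_assoc; exact: path_edge.
apply: homotopic_pcat; last by apply: homotopic_refl; exact: path_edge.
exact: homotopic_edge2 SK _ _ _.
Qed.

(** * From contractible triangles to simple connectivity *)

Section SimplyConnected.
Hypothesis triangles : forall a b c,
  homotopic X (vertex a) (vertex c) (edge2 a b c) (edge a c).

Definition canonical z v w y : R -> V :=
  pcat (vertex v) (line z (vertex v))
    (pcat (vertex w) (edge v w) (line (vertex w) y)).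

Lemma path_to z v : star v z -> path_in X z (vertex v) (line z (vertex v)).
Proof. by move=> /path_to_vertex; apply: path_inW; exact: starS. Qed.

Lemma path_from y v : star v y -> path_in X (vertex v) y (line (vertex v) y).
Proof. by move=> /path_from_vertex; apply: path_inW; exact: starS. Qed.

(** The points w, w' and y share the closed simplex on the support of y, so w-y can be replaced by
    w-w'-y; then v-w-w' contracts to v-w' by [triangles]. *)
Lemma canonical_indep z v w w' y : star v z -> star w y -> star w' y ->
  homotopic X z y (canonical z v w y) (canonical z v w' y).
Proof.
move=> zv [Xy yw] [_ yw'].
have yK : (supp y) \in K by case: Xy.
apply: homotopic_pcat; first by apply: homotopic_refl; exact: path_to.
apply: (@homotopic_trans _ _ _ _ _ (pcat (vertex w) (edge v w)
    (pcat (vertex w') (edge w w') (line (vertex w') y)))).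
  apply: homotopic_pcat; first by apply: homotopic_refl; exact: path_edge.
  have Sw := @simplex_vertex (supp y) w.
  have Sw' := @simplex_vertex (supp y) w'.
  have Sy := simplex_supp Xy; rewrite !inE in Sw Sw'.
  apply: (homotopic_simplex yK); first by apply: path_simplex => //; exact: Sw.
  apply: path_in_pcat; apply: path_simplex => //; [exact: Sw|..];
  exact: Sw'.
apply: (@homotopic_trans _ _ _ _ _ (pcat (vertex w') (edge2 v w w')
    (line (vertex w') y))).
  apply: homotopic_sym; apply: homotopic_assoc; [exact: path_edge..|].
  exact: path_from.
apply: homotopic_pcat; first exact: triangles.
by apply: homotopic_refl; exact: path_from.
Qed.

(** After reassociation, the part from [u] through y to y' stands alone. It lies in the star of [u],
    where it is homotopic to the segment from [u] to y'. *)
Lemma canonical_extend z v u y y' g : star v z -> star u y ->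
  path_in (star u) y y' g ->
  homotopic X z y' (pcat y (canonical z v u y) g) (canonical z v u y').
Proof.
move=> zv yu pg.
have yu' : star u y' by case: pg => _ gu _ /(_ 1 (lexx _)) <-; exact: gu.
have pgX : path_in X y y' g by apply: path_inW pg; exact: starS.
have pzv := path_to zv; have puy := path_from yu; have pvu := path_edge v u.
apply: (@homotopic_trans _ _ _ _ _ (pcat (vertex v) (line z (vertex v))
    (pcat y (pcat (vertex u) (edge v u) (line (vertex u) y)) g))).
  by apply: homotopic_assoc => //; exact: path_in_pcat pvu puy.
apply: homotopic_pcat; first exact: homotopic_refl.
apply: (@homotopic_trans _ _ _ _ _ (pcat (vertex u) (edge v u)
    (pcat y (line (vertex u) y) g))); first exact: homotopic_assoc.
apply: homotopic_pcat; first exact: homotopic_refl.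
apply: (@homotopic_star u); last exact: path_from_vertex.
by apply: path_in_pcat pg; exact: path_from_vertex.
Qed.

(** Some barycentric coordinate of [f s] is nonzero, and by continuity it stays nonzero nearby. *)
Lemma star_nbhs f s : continuous f -> (forall s, X (f s)) ->
  exists u, exists2 e : R, 0 < e &
    forall s', `|s - s'| < e -> star u (f s').
Proof.
move=> cf fX; have [_ f1 _] := fX s; have := supp_gt0 f1.
case/card_gt0P => u; rewrite inE => fu; exists u.
have cu : continuous (fun s => f s ord0 u).
  by move=> r; apply: (@continuous_comp _ _ _ f (fun M : V => M ord0 u));
    [exact: cf|exact: coord_continuous].
have : \forall s' \near s, f s' ord0 u != 0.
  apply: (cu s [set r : R | r != 0]); apply: open_nbhs_nbhs.
  by split => //; exact: open_neq.
move=> /nbhs_ballP[e /= e0 he]; exists e => // s' ss'; split => //; exact: he.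
Qed.

Lemma path_canonical z y f v : path_in X z y f -> star v z ->
  forall s w, star w (f s) ->
  homotopic X z (f s) (fun r => f (s * clamp r)) (canonical z v w (f s)).
Proof.
move=> [cf fX f0 f1] zv.
(* [P] ranges over all [w] so that it can be used at the vertex [u] whose star contains the path
   near the given parameter. *)
pose P s := forall w, star w (f s) ->
  homotopic X z (f s) (fun r => f (s * clamp r)) (canonical z v w (f s)).
(* Within one ball [P] passes from any parameter to any other. From the centre outwards this gives
   openness of [P], towards the centre openness of its complement. *)
have step s0 u e s s' : (forall s', `|s0 - s'| < e -> star u (f s')) ->
    `|s0 - s| < e -> `|s0 - s'| < e -> P s -> P s'.
  move=> fu hs hs' Ps w ws'; have us := fu _ hs; have us' := fu _ hs'.
  pose g r := f (s + clamp r * (s' - s)).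
  have pg : path_in (star u) (f s) (f s') g.
    split; rewrite /g.
    - by cont.
    - move=> r; apply: fu; move: hs hs'; rewrite !ltr_norml.
      move=> /andP[a1 a2] /andP[b1 b2]; have [q0|q0] := leP (clamp r) 0.
        by rewrite (_ : clamp r = 0); have := clamp_ge0 r; lra.
      have := clamp_le1 r; move: (clamp r) q0 => q q0 q1.
      by apply/andP; split; nra.
    - by move=> r ?; rewrite clamp_le0 // mul0r addr0.
    - by move=> r ?; rewrite clamp_ge1 // mul1r addrC subrK.
  apply: (homotopic_trans _ (canonical_indep zv us' ws')).
  apply: (homotopic_trans _ (canonical_extend zv us pg)).
  (* [phi] goes from 0 to s, then from s to s', so that [f \o phi] is the concatenation of [f] up to
     s with [g]; it reparametrizes [f] up to s'. *)
  pose phi r := s * clamp (2 * r) + clamp (2 * r - 1) * (s' - s).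
  apply: (@homotopic_trans _ _ _ _ _ (f \o phi)).
    rewrite -[z](f0 0) //.
    apply: (@homotopic_reparam _ _ _ f (fun r => s' * clamp r)) => //.
    - by cont.
    - by rewrite /phi; cont.
    - move=> r ?; rewrite /phi !clamp_le0 ?mul0r ?mulr0 ?addr0 //; lra.
    - move=> r ?.
      rewrite /phi !clamp_ge1 ?mul1r ?mulr1 ?[_ + (_ - _)]addrC ?subrK //; lra.
  rewrite (_ : f \o phi = pcat (f s) (fun r => f (s * clamp r)) g).
    by apply: homotopic_pcat; [exact: Ps|apply: homotopic_refl;
      apply: path_inW pg; exact: starS].
  apply/funext => r; rewrite /pcat /g /phi /=.
  have [h|h] := leP (2 * r) 1.
    by rewrite [clamp (_ - _)]clamp_le0 ?mul0r ?addr0 ?addrK //; lra.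
  rewrite [clamp (2 * r)]clamp_ge1 ?mulr1; last by lra.
  by rewrite [f s + _]addrC addrK.
(* At 0 the path is constant at z, and the canonical path through [v] alone stays in the star of
   [v]. *)
have P0 : P 0.
  move=> w; rewrite f0 // => zw.
  apply: (homotopic_trans _ (canonical_indep zv zv zw)).
  apply: (@homotopic_star v).
    by split => [|s|s _|s _]; rewrite ?mul0r ?f0 //; cont.
  apply: path_in_pcat; first exact: path_to_vertex.
  apply: path_in_pcat; last exact: path_from_vertex.
  exact: path_from_vertex (star_vertex v).
suff PT : [set s | P s] = setT.
  by move=> s; have : [set s | P s] s by rewrite PT.
have [oP cP] : open [set s | P s] /\ closed [set s | P s].
  split.
    rewrite openE => s /= Ps; have [u [e e0 fu]] := star_nbhs s cf fX.
    apply/nbhs_ballP; exists e => //= s' ss'.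
    by apply: (step _ _ _ _ _ fu _ _ Ps) => //; rewrite subrr normr0.
  rewrite -openC openE => s /= Ps; have [u [e e0 fu]] := star_nbhs s cf fX.
  apply/nbhs_ballP; exists e => //= s' ss' Ps'; apply: Ps.
  by apply: (step _ _ _ _ _ fu _ _ Ps') => //; rewrite subrr normr0.
have : connected [set: R] by apply/connected_intervalP.
apply; first by exists 0.
- by exists [set s | P s] => //; rewrite setTI.
- by exists [set s | P s] => //; rewrite setTI.
Qed.

Lemma homotopic_loops x f g : X x -> path_in X x x f -> path_in X x x g ->
  homotopic X x x f g.
Proof.
move=> Xx.
have [v xv] : exists v, star v x.
  have [_ x1 _] := Xx; have /card_gt0P[v] := supp_gt0 x1.
  by rewrite inE => xv; exists v.
have C h : path_in X x x h -> homotopic X x x h (canonical x v v x).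
  move=> ph; have [ch hX h0 h1] := ph.
  have := @path_canonical _ _ _ v ph xv 1 v; rewrite h1 // => /(_ xv).
  (* At s = 1 the clamped path is [h] itself, because [h] is constant outside [0, 1]. *)
  rewrite (_ : (fun r => _) = h) //; apply/funext => r; rewrite mul1r.
  case: (clampP r) => -[h' -> //]; first by rewrite h0 // h0.
  by rewrite h1 // h1.
move=> /C Cf /C Cg; apply: (homotopic_trans Cf); exact: homotopic_sym.
Qed.

(** Continuity within [0, 1] is enough, since [clamp] is continuous and takes its values there. *)
Lemma loop_path x f : loop (R := R) X x f -> path_in X x x (f \o @clamp R).
Proof.
have cI s : `[0 : R, 1]%classic (clamp s) by rewrite /= in_itv /= clamp_itv.
move=> [cf fX f0 f1]; split.
- move=> s U fU; move/subspace_continuousP: cf => /(_ _ (cI s)) /(_ U fU).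
  rewrite nbhs_simpl /within /= => fU'.
  have cfU :
      nbhs s [set r | `[0 : R, 1]%classic (clamp r) -> U (f (clamp r))] :=
    @cont_clamp R _ _ (@cont_id R) s _ fU'.
  by apply: (filterS _ cfU) => r /=; apply; exact: cI.
- by move=> s; apply: fX; exists (clamp s) => //; exact: cI.
- by move=> s s0 /=; rewrite clamp_le0.
- by move=> s s0 /=; rewrite clamp_ge1.
Qed.

Lemma simply_connected : pi1_trivial R X.
Proof.
move=> x Xx.
have hom f g : loop (R := R) X x f -> loop (R := R) X x g ->
    loop_homotopic X x f g.
  move=> lf lg.
  have [H [cH HX H0 H1 [Hx Hy]]] :=
    homotopic_loops Xx (loop_path lf) (loop_path lg).
  exists H; split.
  - exact: continuous_subspaceT.
  - by move=> _ [q _ <-]; exact: HX.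
  - by move=> s; rewrite /= in_itv /= => s01; rewrite H0 // H1 //= clamp_id.
  - by move=> t _; split; [exact: Hx|exact: Hy].
have lc : loop (R := R) X x (cst x).
  split => //; last by move=> _ [? _ <-].
  exact: cst_continuous.
have E f : loop (R := R) X x f -> loop_class X x f = loop_class X x (cst x).
  by move=> lf; apply/seteqP; split => g [lg _]; split => //; exact: hom.
apply/seteqP; split => [_ [f lf <-]|_ ->] /=; first exact: E.
by exists (cst x).
Qed.
End SimplyConnected.
End Realization.

(** * Connected common links and simple connectivity *)

Section Links.
Variable n : nat.
Implicit Types (F : {set {set 'I_n}}) (a b c x y : 'I_n).

(** Adjacency in the intersection of the links of [a] and [b]. When [F] consists of triples, [a] and
    [b] are isolated. *)
Definition link_rel F a b : rel 'I_n :=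
  fun x y => ([set a; x; y]%SET \in F) && ([set b; x; y]%SET \in F).

Definition links_connected F : Prop :=
  forall a b x y, a != b ->
    x \notin [set a; b]%SET -> y \notin [set a; b]%SET ->
    connect (link_rel F a b) x y.

Lemma cards3 a b c : (#|[set a; b; c]%SET| == 3) = [&& a != b, a != c & b != c].
Proof.
rewrite finset.setUC cardsU1 cards2 !inE [c == a]eq_sym [c == b]eq_sym.
by case: (a == b); case: (a == c); case: (b == c).
Qed.

Lemma link_rel_sym F a b : symmetric (link_rel F a b).
Proof.
move=> x y; rewrite /link_rel.
by rewrite (finset.setUAC [set a]%SET) (finset.setUAC [set b]%SET).
Qed.

Variable R : realType.

Lemma links_connected_pi1_trivial F : (3 < n)%N -> F \subset triples n ->
  links_connected F -> pi1_trivial R (realization R (LM_complex F)).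
Proof.
move=> n3 FT lF; set K := LM_complex F.
have FK t : t \in F -> t \in K by rewrite inE => ->; rewrite orbT.
have K2 (s : {set 'I_n}) : (0 < #|s| <= 2)%N -> s \in K by rewrite inE => ->.
have Kcl (s t : {set 'I_n}) : t \in K -> s \subset t -> (0 < #|s|)%N -> s \in K.
  rewrite !inE => /orP[/andP[_ t2]|tF] st ->.
    by rewrite (leq_trans (subset_leq_card st) t2).
  have /fintype.subsetP/(_ _ tF) := FT; rewrite inE => /eqP t3.
  have [->|neq] := eqVneq s t; first by rewrite tF orbT.
  have : (#|s| < #|t|)%N by apply: proper_card; rewrite finset.properEneq neq.
  by rewrite t3 ltnS => ->.
apply: (simply_connected K2 Kcl) => a b c.
have [abc|] := boolP (#|[set a; b; c]%SET| == 3); last first.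
  move=> n3'; apply: (homotopic_edge2 _ Kcl (S := [set a; b; c]%SET)).
  - apply: K2; rewrite card_gt0; apply/andP; split.
      by apply/finset.set0Pn; exists a; rewrite !inE eqxx.
    suff : (#|[set a; b; c]%SET| <= 3)%N by rewrite leq_eqVlt (negbTE n3').
    rewrite (leq_trans (leq_card_setU _ _)) // cards1 addn1 ltnS.
    by rewrite (leq_trans (leq_card_setU _ _)) // !cards1.
  - by rewrite !inE eqxx.
  - by rewrite !inE eqxx orbT.
  - by rewrite !inE eqxx orbT.
have /and3P[ab ac bc] : [&& a != b, a != c & b != c] by rewrite -cards3.
(* A fourth vertex b' exists as n > 3. The first edge c-d of a path from c to b in the common link
   of a and b' yields the face acd. *)
have [d dac] : exists d, [set a; d; c]%SET \in F.
  have [b' b'abc] : exists b', b' \notin [set a; b; c]%SET.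
    apply/existsP; rewrite -negb_forall; apply/negP => /forallP all.
    have : [set: 'I_n]%SET \subset [set a; b; c]%SET.
      by apply/fintype.subsetP => i _; exact: all.
    by move=> /subset_leq_card; rewrite cardsT card_ord (eqP abc) leqNgt n3.
  have ab' : a != b' by apply: contraNneq b'abc => <-; rewrite !inE eqxx.
  have cb' : c != b' by apply: contraNneq b'abc => <-; rewrite !inE eqxx orbT.
  have bb' : b != b' by apply: contraNneq b'abc => <-; rewrite !inE eqxx orbT.
  have /connectP[] : connect (link_rel F a b') c b.
    by apply: lF => //; rewrite !inE negb_or eq_sym ?ac ?ab.
  case=> [_ /= cb|d p /= /andP[cd _] _]; first by rewrite cb eqxx in bc.
  by exists d; move: cd; rewrite /link_rel finset.setUAC => /andP[].
have d_ac : d \notin [set a; c]%SET.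
  have /fintype.subsetP/(_ _ dac) := FT; rewrite inE cards3 => /and3P[ad _ dc].
  by rewrite !inE negb_or eq_sym ad.
have b_ac : b \notin [set a; c]%SET by rewrite !inE negb_or eq_sym ab.
(* Each edge of a path from b to d in the common link of a and c allows one swap; together they turn
   a-b-c into a-d-c, which bounds a face. *)
have /connectP[q pq dq] := lF a c b d ac b_ac d_ac.
have swap x y : link_rel F a c x y ->
    homotopic (realization R K) (vertex R a) (vertex R c)
      (edge2 a x c) (edge2 a y c).
  move=> /andP[axy cxy].
  by apply: (homotopic_edge2_swap _ K2 Kcl (S := [set a; x; y]%SET)
    (T := [set c; x; y]%SET)); rewrite ?FK // !inE ?eqxx ?orbT.
have bd : homotopic (realization R K) (vertex R a) (vertex R c)
    (edge2 a b c) (edge2 a d c).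
  rewrite dq; elim: q (b) pq {dq} => [|x q IH] b0 /=.
    by move=> _; apply: homotopic_refl; exact: path_edge2.
  by move=> /andP[/swap h /IH]; exact: homotopic_trans.
apply: (homotopic_trans bd).
by apply: (homotopic_edge2 _ Kcl (S := [set a; d; c]%SET));
  rewrite ?FK // !inE ?eqxx ?orbT.
Qed.

(** [S] is the component of a vertex in a disconnected common link, or its complement there,
    whichever has at most half of the n - 2 vertices. *)
Lemma not_links_connected F : ~ links_connected F ->
  exists a b, exists S : {set 'I_n}, [/\ a != b, S \subset ~: [set a; b]%SET,
    (0 < #|S|)%N, (#|S|.*2 <= n - 2)%N &
    forall x y, x \in S -> y \in ~: [set a; b]%SET :\: S ->
      ~~ link_rel F a b x y].
Proof.
move=> nF.
have [a [b [x [y [ab xU yU nxy]]]]] : exists a b x y, [/\ a != b,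
    x \notin [set a; b]%SET, y \notin [set a; b]%SET &
    ~~ connect (link_rel F a b) x y].
  apply: contrapT => h; apply: nF => a b x y ab xU yU.
  by apply/negPn/negP => nxy; apply: h; exists a, b, x, y.
exists a, b; set U := (~: [set a; b])%SET.
pose C := [set z in U | connect (link_rel F a b) x z]%SET.
have CU : C \subset U by apply/fintype.subsetP => z; rewrite inE => /andP[].
have cardU : #|U| = (n - 2)%N.
  by rewrite cardsCs finset.setCK card_ord cards2 ab.
have nC u v : u \in C -> v \in U :\: C -> ~~ link_rel F a b u v.
  rewrite !inE => /andP[_ xu] /andP[+ vU]; apply: contra => uv.
  by rewrite vU (connect_trans xu) ?connect1.
have [h|h] := leqP #|C|.*2 (n - 2).
  exists C; split => //; rewrite card_gt0; apply/finset.set0Pn; exists x.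
  by rewrite inE connect0 andbT inE.
exists (U :\: C); split => //.
- exact: finset.subsetDl.
- rewrite card_gt0; apply/finset.set0Pn; exists y.
  by rewrite !inE negb_and nxy orbT; move: yU; rewrite !inE.
- have := subset_leq_card CU; rewrite cardsD (finset.setIidPr CU) cardU.
  rewrite -!addnn in h *; move: h; move: #|C| (n - 2)%N => k m; lia.
- move=> u v uC.
  rewrite finset.setDDr finset.setDv finset.set0U => /finset.setIP[_ vC].
  by rewrite link_rel_sym; exact: nC.
Qed.
End Links.

(** * Means over random subsets *)

Section RandomSubset.
Variables (R : comPzRingType) (T : finType) (p : R).
Implicit Types (D F : {set T}) (phi psi : {set T} -> R).

(* The mean of phi over a random subset of D that contains each element of D
   independently with probability p. *)
Definition subset_mean D phi : R :=
  \sum_(F in powerset D)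
    (\prod_(t in D) (if t \in F then p else 1 - p)) * phi F.

Lemma eq_subset_mean D phi psi : (forall F, F \subset D -> phi F = psi F) ->
  subset_mean D phi = subset_mean D psi.
Proof. by move=> h; apply: eq_bigr => F; rewrite finset.powersetE => /h ->. Qed.

Lemma subset_mean_sum (I : finType) (P : pred I) D (phi : I -> {set T} -> R) :
  subset_mean D (fun F => \sum_(i | P i) phi i F) =
  \sum_(i | P i) subset_mean D (phi i).
Proof.
by rewrite /subset_mean exchange_big; apply: eq_bigr => F _; rewrite mulr_sumr.
Qed.

(** Conditioning on whether t is chosen; subsets containing t correspond to subsets of [D :\ t] by
    adding t. *)
Lemma subset_mean_condition D t phi : t \in D ->
  subset_mean D phi = p * subset_mean (D :\ t) (fun F => phi (t |: F)%SET)
                      + (1 - p) * subset_mean (D :\ t) phi.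
Proof.
move=> tD; rewrite /subset_mean (bigID (fun F : {set T} => t \in F)) /=.
congr (_ + _).
  rewrite (reindex_onto (fun F => t |: F)%SET (fun F => F :\ t)%SET) /=; last first.
    by move=> F /andP[_ tF]; rewrite finset.setD1K.
  rewrite big_distrr /=; apply: eq_big => [F|F /andP[/andP[_ _] /eqP tF]].
    rewrite !finset.powersetE finset.setU11 andbT finset.subUset finset.sub1set tD.
    rewrite finset.subsetD1 /=; congr (_ && _).
    apply/eqP/idP => [<-|tF]; first by rewrite !inE eqxx.
    by rewrite finset.setU1K.
  rewrite mulrA; congr (_ * _); rewrite (big_setD1 t) //= finset.setU11; congr (_ * _).
  by apply: eq_bigr => i /finset.setD1P[it _]; rewrite !inE (negbTE it).
rewrite big_distrr /=; apply: eq_big => [F|F /andP[_ tF]].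
  by rewrite !finset.powersetE finset.subsetD1.
by rewrite mulrA (big_setD1 t) //= (negbTE tF).
Qed.

Lemma subset_mean1 D : subset_mean D (fun=> 1) = 1.
Proof.
elim: {D}#|D| {-2}D (erefl #|D|) => [|m IH] D.
  move=> /eqP; rewrite cards_eq0 => /eqP ->.
  by rewrite /subset_mean finset.powerset0 big_set1 big_set0 mulr1.
move=> Dm; have /card_gt0P[t tD] : (0 < #|D|)%N by rewrite Dm.
rewrite (subset_mean_condition _ tD) IH; first by ring.
by have := cardsD1 t D; rewrite tD Dm => -[].
Qed.

(** The pairs are disjoint, so the events of missing a member of each pair are independent. The
    induction conditions on both members of the first pair. *)
Lemma subset_mean_no_pair D (s : seq (T * T)) :
  uniq (unzip1 s ++ unzip2 s) -> {subset unzip1 s ++ unzip2 s <= D} ->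
  subset_mean D (fun F => \prod_(q <- s) (~~ ((q.1 \in F) && (q.2 \in F)))%:R)
  = (1 - p ^+ 2) ^+ size s.
Proof.
elim: s D => [|[u w] s IH] D.
  move=> _ _; rewrite expr0 -[RHS](subset_mean1 D).
  by apply: eq_subset_mean => F _; rewrite big_nil.
pose phi F : R := \prod_(q <- s) (~~ ((q.1 \in F) && (q.2 \in F)))%:R.
rewrite /= cat_uniq /= mem_cat negb_or inE negb_or.
move=> /and5P[/and3P[us uw us'] us1 + ws us2].
rewrite negb_or => /andP[ws1 s12] sD.
have us0 : uniq (unzip1 s ++ unzip2 s).
  by rewrite cat_uniq us1 us2 andbT.
have uD : u \in D by apply: sD; rewrite inE eqxx.
have wD : w \in D :\ u.
  by rewrite !inE eq_sym uw; apply: sD; rewrite inE mem_cat inE eqxx !orbT.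
have sDu : {subset unzip1 s ++ unzip2 s <= D :\ u}.
  move=> i si; rewrite !inE; apply/andP; split.
    apply: contraTneq si => ->; by rewrite mem_cat negb_or us us'.
  apply: sD; move: si; rewrite inE !mem_cat inE.
  by move=> /orP[->|->]; rewrite !orbT.
have sDuw : {subset unzip1 s ++ unzip2 s <= (D :\ u) :\ w}.
  move=> i si; rewrite finset.in_setD1 sDu // andbT.
  by apply: contraTneq si => ->; rewrite mem_cat negb_or ws1 ws.
have phiu F : phi (u |: F)%SET = phi F.
  apply: eq_big_seq => q qs.
  have q1 : q.1 != u by apply: contraTneq (map_f fst qs) => ->.
  have q2 : q.2 != u by apply: contraTneq (map_f snd qs) => ->.
  by rewrite !inE (negbTE q1) (negbTE q2).
(* If both members are chosen the product vanishes; the other cases have weights p(1 - p) and 1 - p,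
   whose sum is 1 - p^2. *)
rewrite (subset_mean_condition _ uD) (subset_mean_condition _ wD).
rewrite (_ : subset_mean _ _ = 0); last first.
  rewrite /subset_mean big1 // => F _; rewrite big_cons /= !inE !eqxx ?orbT /=.
  by rewrite mul0r mulr0.
rewrite (@eq_subset_mean _ _ phi); last first.
  move=> F; rewrite finset.subsetD1 => /andP[_ wF].
  rewrite big_cons /= !inE eqxx /= (eq_sym w) (negbTE uw) (negbTE wF) mul1r.
  exact: phiu.
rewrite (@eq_subset_mean (D :\ u) _ phi); last first.
  move=> F; rewrite finset.subsetD1 => /andP[_ uF].
  by rewrite big_cons /= (negbTE uF) mul1r.
by rewrite !IH // [_ ^+ (size s).+1]exprS; move: (_ ^+ size s) => e; ring.
Qed.
End RandomSubset.

(** * Union bound over cuts of common links *)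

Section UnionBound.
Variables (R : realType) (n : nat) (p : R).
Hypothesis p01 : 0 <= p <= 1.
Implicit Types (F S : {set {set 'I_n}}) (a b x y : 'I_n).

Definition cut F a b (S : {set 'I_n}) : bool :=
  [forall x in S, forall y in ~: [set a; b] :\: S, ~~ link_rel F a b x y].

Lemma LM_weight_ge0 F : 0 <= LM_weight p F.
Proof.
apply: prodr_ge0 => t _; case: p01 => /andP[p0 p1].
by case: ifP => _ //; rewrite subr_ge0.
Qed.

(** For x in [S] and y outside [S], a and b, the faces axy and bxy must not both occur. Different
    (x, y) give disjoint pairs of faces, so [subset_mean_no_pair] applies. *)
Lemma subset_mean_cut_le a b (S : {set 'I_n}) : a != b ->
  S \subset ~: [set a; b]%SET ->
  subset_mean p (triples n) (fun F => (cut F a b S)%:R) <=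
  (1 - p ^+ 2) ^+ (#|S| * (n - 2 - #|S|)).
Proof.
move=> ab SU; set U := (~: [set a; b])%SET in SU *.
pose st (v : 'I_n) (q : 'I_n * 'I_n) := [set v; q.1; q.2]%SET.
pose J := enum (finset.setX S (U :\: S)).
pose s := [seq (st a q, st b q) | q <- J].
have cardU : #|U| = (n - 2)%N.
  by rewrite cardsCs finset.setCK card_ord cards2 ab.
have sizes : size s = (#|S| * (n - 2 - #|S|))%N.
  by rewrite size_map -cardE cardsX cardsD (finset.setIidPr SU) cardU.
have J1 q : q \in J -> [/\ q.1 \in S, q.2 \in U :\: S, q.1 \in U & q.1 != q.2].
  rewrite mem_enum !inE => /andP[q1 /andP[q2 q2U]]; split => //.
  - by rewrite q2 q2U.
  - by have /fintype.subsetP/(_ _ q1) := SU; rewrite !inE.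
  - by apply: contraNneq q2 => <-.
(* The face vxy determines (x, y): x is its only vertex in [S], and y is its only vertex other than
   v outside [S]. *)
have stinj v : v \in [set a; b]%SET -> {in J &, injective (st v)}.
  move=> vab [x y] [x' y'] /J1[/= xS yS xU xy] /J1[/= x'S y'S x'U x'y'] E.
  have vn z : z \in U -> (z == v) = false.
    by rewrite finset.in_setC => h; apply: contraNF h => /eqP ->.
  have yU : y \in U by case/finset.setDP: yS.
  have y'U : y' \in U by case/finset.setDP: y'S.
  have yS' : y \notin S by case/finset.setDP: yS.
  have y'S' : y' \notin S by case/finset.setDP: y'S.
  have nn z w : z \in S -> w \notin S -> (z == w) = false.
    by move=> zS; apply: contraNF => /eqP <-.
  have : (x \in _) = (x \in _) :=
    congr1 (fun A : {set 'I_n} => x \in A) E.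
  rewrite !inE eqxx vn //= (nn x y') // orbF => /esym/eqP ->.
  have : (y \in _) = (y \in _) :=
    congr1 (fun A : {set 'I_n} => y \in A) E.
  rewrite !inE eqxx (vn y) //= orbT eq_sym (nn x') // => /esym/eqP ->.
  by [].
have st3 v q : v \in [set a; b]%SET -> q \in J -> st v q \in triples n.
  move=> vab /J1[_ /finset.setDP[q2U _] q1U q12]; rewrite inE cards3 q12 andbT.
  have vn z : z \in U -> v != z.
    by rewrite finset.in_setC => h; apply: contraNneq h => <-.
  by rewrite !vn.
have aab : a \in [set a; b]%SET by rewrite !inE eqxx.
have bab : b \in [set a; b]%SET by rewrite !inE eqxx orbT.
have s1 : unzip1 s = map (st a) J by rewrite /unzip1 -map_comp.
have s2 : unzip2 s = map (st b) J by rewrite /unzip2 -map_comp.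
rewrite -sizes -(@subset_mean_no_pair _ _ _ (triples n)).
- rewrite /subset_mean; apply: ler_sum => F _; apply: ler_wpM2l.
    exact: LM_weight_ge0.
  have [/forall_inP h|_] := boolP (cut F a b S); last first.
    by apply: prodr_ge0 => q _; rewrite ler0n.
  rewrite big1_seq // => q /andP[_ /mapP[[x y] /J1[/= xS yS _ _] ->]] /=.
  by move: (h _ xS) => /forall_inP/(_ _ yS); rewrite /link_rel => ->.
- rewrite cat_uniq s1 s2 !map_inj_in_uniq ?enum_uniq ?andTb ?andbT;
    try exact: stinj.
  (* No face of the first family is one of the second: only the former contain a. *)
  apply/hasPn => _ /mapP[q /J1[_ /finset.setDP[q2U _] q1U _] ->].
  apply/mapP => -[q' /J1[_ /finset.setDP[q'2U _] q'1U _] E].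
  have : (a \in _) = (a \in _) :=
    congr1 (fun A : {set 'I_n} => a \in A) E.
  move: q1U q2U; rewrite !inE eqxx (negbTE ab) /= !negb_or.
  by rewrite ![_ == a]eq_sym => /andP[/negbTE -> _] /andP[/negbTE -> _].
- move=> t; rewrite mem_cat s1 s2 => /orP[] /mapP[q qJ ->]; exact: st3.
Qed.

Lemma LM_prob_compl (Q : {set {set 'I_n}} -> Prop) :
  1 - LM_prob p Q =
  subset_mean p (triples n) (fun F => (~~ `[< Q (LM_complex F) >])%:R).
Proof.
rewrite -[X in X - _](subset_mean1 p (triples n)) /subset_mean /LM_prob.
rewrite (bigID (fun F : {set {set 'I_n}} => `[< Q (LM_complex F) >])) /=.
rewrite [RHS](bigID (fun F : {set {set 'I_n}} => `[< Q (LM_complex F) >])) /=.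
rewrite [X in _ = X + _]big1; last by move=> F /andP[_ ->]; rewrite mulr0.
rewrite add0r addrAC [X in X - _](_ : _ =
  \sum_(F in powerset (triples n) | `[< Q (LM_complex F) >]) LM_weight p F).
  by rewrite subrr add0r; apply: eq_bigr => F /andP[_ ->].
by apply: eq_bigr => F _; rewrite mulr1.
Qed.

Lemma LM_prob_le1 (Q : {set {set 'I_n}} -> Prop) : LM_prob p Q <= 1.
Proof.
rewrite -subr_ge0 LM_prob_compl; apply: sumr_ge0 => F _.
by rewrite mulr_ge0 ?ler0n //; exact: LM_weight_ge0.
Qed.

Definition small_cut a b (S : {set 'I_n}) : bool :=
  [&& a != b, S \subset ~: [set a; b]%SET, (0 < #|S|)%N & (#|S|.*2 <= n - 2)%N].

(** Whenever the group is nontrivial, [not_links_connected] supplies a small cut, so the indicator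
    of failure is at most the sum of the cut indicators. *)
Lemma LM_prob_union_bound : (3 < n)%N ->
  1 - LM_prob p (fun Y : {set {set 'I_n}} => pi1_trivial R (realization R Y)) <=
  \sum_(a : 'I_n) \sum_(b : 'I_n) \sum_(S | small_cut a b S)
    (1 - p ^+ 2) ^+ (#|S| * (n - 2 - #|S|)).
Proof.
move=> n3; rewrite LM_prob_compl.
apply: (@le_trans _ _ (subset_mean p (triples n) (fun F =>
    \sum_a \sum_b \sum_(S | small_cut a b S) (cut F a b S)%:R))); last first.
  rewrite subset_mean_sum; apply: ler_sum => a _.
  rewrite subset_mean_sum; apply: ler_sum => b _.
  rewrite subset_mean_sum; apply: ler_sum => S /and4P[ab SU _ _].
  exact: subset_mean_cut_le.
apply: ler_sum => F; rewrite finset.powersetE => FT.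
apply: ler_wpM2l; first exact: LM_weight_ge0.
have [_|/asboolP nQ] := boolP `[< _ >].
  apply: sumr_ge0 => a _; apply: sumr_ge0 => b _; apply: sumr_ge0 => S _.
  by rewrite ler0n.
have : ~ links_connected F.
  by move=> lF; apply: nQ; exact: links_connected_pi1_trivial.
move=> /not_links_connected[a [b [S [ab SU S0 Sn noedge]]]].
have cutS : cut F a b S.
  by apply/forall_inP => x xS; apply/forall_inP => y yS; exact: noedge.
rewrite (bigD1 a) //= (bigD1 b) //= (bigD1 S) /= ?cutS; last first.
  by rewrite /small_cut ab SU S0 Sn.
rewrite -!addrA lerDl; apply: addr_ge0.
  by apply: sumr_ge0 => ? _; rewrite ler0n.
apply: addr_ge0; apply: sumr_ge0 => ? _; apply: sumr_ge0 => ? _ //.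
by apply: sumr_ge0 => ? _; rewrite ler0n.
Qed.
End UnionBound.

(** * Numerical estimates and the limit *)

Section Estimates.
Variable R : realType.

Lemma bin_leq_expn m k : ('C(m, k) <= m ^ k)%N.
Proof.
apply: (@leq_trans (m ^_ k)); first by rewrite -bin_ffact leq_pmulr ?fact_gt0.
elim: k => // k IH; rewrite ffactnSr expnSr leq_mul // leq_subr //.
Qed.

(** For k = 1 the exponent n - 3 costs at most 3q <= 3, hence [3 - w]; each further vertex gains a
    factor 1/e <= 1/2. The factor n^-2 pays for the choice of a and b. *)
Lemma cut_term_le (n k : nat) (q w : R) : 0 <= q <= 1 -> 6 <= w ->
  3 * ln n%:R + w <= q * n%:R -> (3 < n)%N -> (0 < k)%N -> (k.*2 <= n - 2)%N ->
  'C(n - 2, k)%:R * (1 - q) ^+ (k * (n - 2 - k)) <=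
  2 * expR (3 - w) / n%:R ^+ 2 * (1 / 2) ^+ k.
Proof.
move=> /andP[q0 q1] w6 qn n3 k0 kn.
have n0 : 0 < n%:R :> R by rewrite ltr0n; lia.
set L := ln n%:R in qn.
have L0 : 0 <= L by apply: ln_ge0; rewrite ler1n; lia.
have nE : n%:R = expR L by rewrite lnK.
have kR : 1 <= k%:R :> R by rewrite ler1n.
have jE : (k * (n - 2 - k))%:R = k%:R * (n%:R - 2 - k%:R) :> R.
  by rewrite natrM !natrB //; lia.
have k2 : 2 * k%:R <= n%:R - 2 :> R.
  by rewrite -natrM -natrB ?ler_nat; lia.
apply: (@le_trans _ _ (expR (k%:R * L) * expR ((k * (n - 2 - k))%:R * - q))).
  apply: ler_pM; rewrite ?ler0n ?exprn_ge0 ?subr_ge0 //.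
    rewrite expRM_natl -nE -natrX ler_nat (leq_trans (bin_leq_expn _ _)) //.
    by rewrite leq_exp2r // leq_subr.
  rewrite expRM_natl lerXn2r ?nnegrE ?subr_ge0 ?expR_ge0 //.
  exact: expR_ge1Dx.
apply: (@le_trans _ _ (expR (- (2%:R * L) + (3 - w) + k.-1%:R * - 1))).
  (* k(m-k) >= (m-1) + (k-1)(m-2)/2 for m = n - 2, and q(m-2)/2 >= L + 1 *)
  rewrite -expRD ler_expR jE -subn1 natrB //.
  move: (k%:R) (n%:R) kR k2 qn => K N K1 K2 qn.
  have h1 : 0 <= q * (K - 1) * (N - 2 - K - 1 - (N - 4) / 2).
    by rewrite !mulr_ge0 //; lra.
  (* Since 4q <= 4, q(N - 4) is at least 3L + w - 4, and w >= 6 makes this at least 2L + 2. *)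
  have h2 : 0 <= (K - 1) * (q * (N - 4) / 2 - L - 1).
    by rewrite mulr_ge0 //; nra.
  nra.
rewrite !expRD expRN !expRM_natl -nE.
have E (x y h : R) : 2 * x / y * h = y^-1 * x * (2 * h) by ring.
rewrite E.
rewrite ler_wpM2l ?mulr_ge0 ?expR_ge0 ?invr_ge0 ?exprn_ge0 ?ler0n //.
case: k k0 {kn kR jE k2} => // k _; rewrite exprS mulrA.
rewrite (_ : 2 * (1 / 2) = 1 :> R) ?mul1r; last by field.
rewrite lerXn2r ?nnegrE ?expR_ge0 ?invr_ge0 //.
rewrite expRN lef_pV2 ?posrE ?expR_gt0 //.
by have := expR_ge1Dx (1 : R); lra.
Qed.

Lemma sum_half_le (m : nat) : \sum_(k < m) (1 / 2) ^+ k <= 2 :> R.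
Proof.
suff -> : \sum_(k < m) (1 / 2) ^+ k = 2 - 2 * (1 / 2) ^+ m :> R.
  by rewrite gerDl oppr_le0 mulr_ge0 // exprn_ge0.
elim: m => [|m IH]; first by rewrite big_ord0 expr0; ring.
by rewrite big_ord_recr /= IH exprS; field.
Qed.

Lemma sum_small_cut_le (n : nat) (a b : 'I_n) (q w : R) :
  0 <= q <= 1 -> 6 <= w -> 3 * ln n%:R + w <= q * n%:R -> (3 < n)%N ->
  \sum_(S | small_cut a b S) (1 - q) ^+ (#|S| * (n - 2 - #|S|)) <=
  4 * expR (3 - w) / n%:R ^+ 2.
Proof.
move=> q01 w6 qn n3; set U := (~: [set a; b])%SET.
have q1 : 0 <= 1 - q by rewrite subr_ge0; case/andP: q01.
pose g k : R := (1 - q) ^+ (k * (n - 2 - k)).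
pose c : R := 2 * expR (3 - w) / n%:R ^+ 2.
have c0 : 0 <= c by rewrite !mulr_ge0 ?expR_ge0 ?invr_ge0 ?exprn_ge0 ?ler0n.
have [ab|ab] := eqVneq a b.
  rewrite big_pred0; last by move=> S; rewrite /small_cut ab eqxx.
  by rewrite !mulr_ge0 ?expR_ge0 ?invr_ge0 ?exprn_ge0 ?ler0n.
have cardU : #|U| = (n - 2)%N.
  by rewrite cardsCs finset.setCK card_ord cards2 ab.
have cardI (S : {set 'I_n}) : small_cut a b S ->
    (inord #|S| : 'I_(n - 2).+1) = #|S| :> nat.
  case/and4P=> _ SU _ _; rewrite inordK // ltnS -cardU.
  exact: subset_leq_card.
(* Cuts are grouped by size; [inord] does not truncate because a small cut has at most n - 2
   vertices. *)
rewrite (partition_big (fun S : {set 'I_n} => inord #|S| : 'I_(n - 2).+1)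
  (fun k => (0 < k)%N && (k.*2 <= n - 2)%N)) /=; last first.
  by move=> S sS; rewrite cardI //; case/and4P: sS => _ _ -> ->.
apply: (@le_trans _ _ (\sum_(k < (n - 2).+1) c * (1 / 2) ^+ k)); last first.
  rewrite -mulr_sumr (_ : 4 * expR (3 - w) / n%:R ^+ 2 = c * 2).
    by rewrite ler_wpM2l // sum_half_le.
  by rewrite /c; ring.
rewrite big_mkcond; apply: ler_sum => k _.
case: ifP => [/andP[k0 kn]|_]; last by rewrite mulr_ge0 // exprn_ge0.
apply: le_trans (cut_term_le q01 w6 qn n3 k0 kn).
rewrite -[X in 'C(X, _)]cardU -cards_draws -/(g k) mulrC mulr_natr -sumr_const.
rewrite big_mkcond [leRHS]big_mkcond; apply: ler_sum => S _.
case: ifP => [/andP[sS /eqP Sk]|_]; last first.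
  by case: ifP => _ //; rewrite exprn_ge0.
have Sk' : #|S| = k by rewrite -(cardI _ sS) Sk.
by rewrite inE Sk' eqxx andbT; case/and4P: sS => _ -> _ _.
Qed.

Lemma LM_pi1_trivial_prob (n : nat) (p w : R) :
  0 <= p <= 1 -> 6 <= w -> (3 < n)%N ->
  Num.sqrt ((3 * ln n%:R + w) / n%:R) <= p ->
  1 - LM_prob p (fun Y : {set {set 'I_n}} => pi1_trivial R (realization R Y)) <=
  4 * expR (3 - w).
Proof.
move=> p01 w6 n3 hp; have /andP[p0 p1] := p01.
have n0 : 0 < n%:R :> R by rewrite ltr0n; lia.
have L0 : 0 <= ln n%:R :> R by apply: ln_ge0; rewrite ler1n; lia.
have qn : 3 * ln n%:R + w <= p ^+ 2 * n%:R.
  rewrite -ler_pdivrMr //.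
  (* [Num.sqrt] is 0 on negative numbers, so squaring the bound on p requires a nonnegative
     radicand. *)
  have h0 : 0 <= (3 * ln n%:R + w) / n%:R by rewrite mulr_ge0 ?invr_ge0; lra.
  by rewrite -(sqr_sqrtr h0) lerXn2r ?nnegrE ?sqrtr_ge0.
have q01 : 0 <= p ^+ 2 <= 1 by rewrite exprn_ge0 //= exprn_ile1.
apply: (le_trans (LM_prob_union_bound p01 n3)).
apply: (@le_trans _ _ (\sum_(a < n) \sum_(b < n) 4 * expR (3 - w) / n%:R ^+ 2)).
  by apply: ler_sum => a _; apply: ler_sum => b _; exact: sum_small_cut_le.
rewrite !sumr_const !card_ord -[_ *+ n *+ n]mulr_natr -[_ / _ *+ n]mulr_natr.
have E (x y : R) : y != 0 -> x / y ^+ 2 * y * y = x by move=> ?; field.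
by rewrite E // gt_eqF.
Qed.
End Estimates.

Theorem theorem1p4 (R : realType) (p omega : nat -> R)
  (p01 : forall n, 0 <= p n <= 1)
  (omega_oo : omega n @[n --> \oo] --> +oo)
  (p_ge : \forall n \near \oo,
     Num.sqrt ((3 * ln n%:R + omega n) / n%:R) <= p n) :
  LM_prob (p n) (fun Y : {set {set 'I_n}} => pi1_trivial R (realization R Y))
    @[n --> \oo] --> (1 : R).
Proof.
apply/cvgrPdist_le => e e0; near=> n.
have n3 : (3 < n)%N by near: n; exact: nbhs_infty_gt.
(* The 6 serves [LM_pi1_trivial_prob]; the rest gives exp(omega - 3) >= omega - 2 >= 4 / e, so that
   4 exp(3 - omega) <= e. *)
have w6 : 6 + 4 / e <= omega n by near: n; move/cvgryPge: omega_oo; exact.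
have e4 : 0 < 4 / e by rewrite divr_gt0.
have w6' : 6 <= omega n by lra.
rewrite ger0_norm ?subr_ge0; last exact: LM_prob_le1.
have hp : Num.sqrt ((3 * ln n%:R + omega n) / n%:R) <= p n by near: n.
apply: (le_trans (LM_pi1_trivial_prob (p01 n) w6' n3 hp)).
have := expR_ge1Dx (omega n - 3).
rewrite -(opprB (omega n)) expRN => h.
rewrite ler_pdivrMr ?expR_gt0 // mulrC -ler_pdivrMr //; lra.
Unshelve. all: by end_near. Qed.
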